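(* Let $(e_i)_{i\in\mathbb N}$ be a greedy basis of a (real) Banach space $X$, with fundamental function $\varphi$. Assume that $\delta(\varphi)>0$. Then for every $\varepsilon>0$ there is an equivalent norm on $X$ with respect to which $(e_i)$ is normalized, $1$-unconditional and $(1+\varepsilon)$-greedy.
   Context: $\mathbb N=\{1,2,\dots\}$. Bases are Schauder bases indexed by $\mathbb N$ and are assumed seminormalized: $0<\inf_i\|e_i\|\le\sup_i\|e_i\|<\infty$. The basis is normalized if $\|e_i\|=1$ for all $i$. It is $K$-unconditional if $\|\sum a_ie_i\|\le K\|\sum b_ie_i\|$ whenever $|a_i|\le|b_i|$ for all $i$. For $x=\sum x_ie_i\in X$ and $m\in\mathbb N$ put $\sigma_m(x)=\inf\{\|x-\sum_{i\in A}a_ie_i\|: A\subset\mathbb N,\ |A|\le m,\ (a_i)_{i\in A}\subset\mathbb R\}$. For each $x$ fix distinct indices $\rho(1),\rho(2),\dots$ (depending on $x$, not necessarily unique) such that $|x_{\rho(1)}|\ge|x_{\rho(2)}|\ge\cdots$ and, for every $m$, $|x_{\rho(m)}|\ge|x_i|$ for all $i\notin\{\rho(1),\dots,\rho(m)\}$; put $\mathcal G_m(x)=\sum_{i=1}^m x_{\rho(i)}e_{\rho(i)}$. The basis is $C$-greedy if $\|x-\mathcal G_m(x)\|\le C\sigma_m(x)$ for all $x\in X$, $m\in\mathbb N$; it is greedy if it is $C$-greedy for some $C>0$. The fundamental function of the basis is $\varphi(n)=\sup_{|A|\le n}\|\sum_{i\in A}e_i\|$, $n\in\mathbb N$ ($A$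 ranging over finite subsets of $\mathbb N$). A function $\varphi\colon[1,\infty)\to(0,\infty)$ is called a fundamental function if $\varphi$ is increasing and $x\mapsto\varphi(x)/x$ is decreasing (both in the non-strict sense). The fundamental function of a basis extends (e.g. by linear interpolation) to a fundamental function on $[1,\infty)$; any such extension is called a fundamental function for $(e_i)$ and is again denoted $\varphi$. For $y\in[1,\infty)$ define $\delta_\varphi(y)=\liminf_{x\to\infty}\frac{\varphi(yx)}{y\varphi(x)}$, and $\delta(\varphi)=\inf_{y\ge1}\delta_\varphi(y)=\lim_{y\to\infty}\delta_\varphi(y)\in[0,1]$. The value $\delta(\varphi)$ depends only on the values of $\varphi$ on $\mathbb N$; equivalently $\delta(\varphi)=\lim_{m\to\infty}\liminf_{n\to\infty}\frac{\varphi(mn)}{m\varphi(n)}$ with $m,n\in\mathbb N$. *)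

(* Defs.v *)
From mathcomp Require Import all_boot all_order all_algebra finmap.
From mathcomp Require Import all_classical all_reals all_analysis.

Set Implicit Arguments.
Unset Strict Implicit.
Unset Printing Implicit Defensive.

Import Order.TTheory GRing.Theory Num.Theory.
Import numFieldTopology.Exports numFieldNormedType.Exports.

Local Open Scope classical_set_scope.
Local Open Scope ring_scope.

(* Bases are indexed by nat from 0. Quantitative notions take the norm as an
   explicit argument N : X -> R, so that they apply both to the given norm of X
   and to a renorming of it. *)

Section Bases.
Context {R : realType} {X : completeNormedModType R}.
Implicit Types (e : nat -> X) (a : nat -> R) (x : X) (N : X -> R).

Definition expansion e x a : Prop :=
  series (fun i => a i *: e i) @ \oo --> x.

Definition schauder_basis e : Prop :=
  forall x, exists! a, expansion e x a.

(* Junk value 0 when x has no expansion; for a Schauder basis these are the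
   coordinates of x. They depend on the topology of X only, hence are the same
   for every equivalent norm. *)
Definition coord e x : nat -> R :=
  xget (fun=> 0) [set a | expansion e x a].

Definition seminormalized N e : Prop :=
  (0 < ereal_inf (range (fun i => (N (e i))%:E)))%E /\
  (ereal_sup (range (fun i => (N (e i))%:E)) < +oo)%E.

Definition normalized N e : Prop := forall i, N (e i) = 1.

(* Since |coord x| <= |coord y| is stated for x, y in X, the
   series on both sides of the inequality converge. *)
Definition unconditional N e (K : R) : Prop :=
  forall x y, (forall i, `|coord e x i| <= `|coord e y i|) -> N x <= K * N y.

(* The error of best m-term approximation. *)
Definition best_error N e (m : nat) x : R :=
  inf [set r | exists (A : {fset nat}) (a : nat -> R),
    (#|` A| <= m)%N /\ r = N (x - \sum_(i <- A) a i *: e i)].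

Definition greedy_ordering e x (rho : nat -> nat) : Prop :=
  [/\ injective rho,
      forall m, `|coord e x (rho m.+1)| <= `|coord e x (rho m)| &
      forall m i, (forall j, (j < m.+1)%N -> i <> rho j) ->
        `|coord e x i| <= `|coord e x (rho m)|].

(* rho x is the ordering chosen for x. *)
Definition greedy_sum e (rho : X -> nat -> nat) (m : nat) x : X :=
  \sum_(i < m) coord e x (rho x i) *: e (rho x i).

Definition greedy_with N e (rho : X -> nat -> nat) (C : R) : Prop :=
  forall x (m : nat), (0 < m)%N ->
    N (x - greedy_sum e rho m x) <= C * best_error N e m x.

Definition greedy N e (rho : X -> nat -> nat) : Prop :=
  exists C : R, 0 < C /\ greedy_with N e rho C.

Definition basis_fundamental N e (n : nat) : R :=
  sup [set r | exists A : {fset nat},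
    (#|` A| <= n)%N /\ r = N (\sum_(i <- A) e i)].

Definition is_norm N : Prop :=
  [/\ forall x y, N (x + y) <= N x + N y,
      forall (c : R) x, N (c *: x) = `|c| * N x &
      forall x, N x = 0 -> x = 0].

Definition equivalent_norms N N' : Prop :=
  exists c C : R, [/\ 0 < c, 0 < C & forall x, c * N x <= N' x <= C * N x].

End Bases.

Section FundamentalFunctions.
Context {R : realType}.
Implicit Types phi : R -> R.

(* Functions on [1, +oo[ are represented by total functions whose values
   outside [1, +oo[ are irrelevant. *)
Definition fundamental_function phi : Prop :=
  [/\ forall x, 1 <= x -> 0 < phi x,
      forall x y, 1 <= x -> x <= y -> phi x <= phi y &
      forall x y, 1 <= x -> x <= y -> phi y / y <= phi x / x].

Definition fundamental_function_for {X : completeNormedModType R}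
    (N : X -> R) (e : nat -> X) phi : Prop :=
  fundamental_function phi /\
  forall n : nat, (0 < n)%N -> phi n%:R = basis_fundamental N e n.

Definition delta_at phi (y : R) : \bar R :=
  limf_einf (fun x : R => (phi (y * x) / (y * phi x))%:E) (pinfty_nbhs R).

Definition delta phi : \bar R :=
  ereal_inf [set delta_at phi y | y in [set y : R | 1 <= y]].

End FundamentalFunctions.

(* Main.v *)
Require Import Defs.
From mathcomp Require Import all_boot all_order all_algebra.
From mathcomp Require Import all_classical all_reals all_analysis.
From mathcomp Require Import finmap ring lra.
(* The vector library also has a coord. *)
Import Defs.

Set Implicit Arguments.
Unset Strict Implicit.
Unset Printing Implicit Defensive.

Import Order.TTheory GRing.Theory Num.Theory.
Import numFieldTopology.Exports numFieldNormedType.Exports.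

Local Open Scope classical_set_scope.
Local Open Scope ring_scope.

(** Let Lambda be the Lorentz norm whose dual norm is sup_E w(E) / phi(|E|), the
    supremum running over the nonempty finite sets E of indices. It is
    invariant under permutations of the coordinates, so the basis is 1-greedy for
    it, and it dominates the given norm up to a constant; but in general it is not
    equivalent to it. The new norm truncates it: it is the supremum of
    sum_i w_i |x_i| over the nonnegative weights w in the intersection of the
    dual ball of Lambda with L times the dual ball of the given norm, divided by
    phi(1) ([truncated_lorentz]). By duality this is, up to constants, the
    K-functional inf over x = y + z of Lambda(y) + L |z|. For each L it is
    equivalent to the given norm, and 1-unconditional; for large L every basis
    vector has norm exactly 1, because the weight phi(1) at a single
    index is then admissible. It remains to see that the greedy constant tends
    to 1 as L grows ([truncated_lorentz_exchange]).

    Let G be a greedy set of x and let A be another set, with |A| <= |G|. Passing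
    from x - P_G x to x minus an approximation supported by A trades the
    coordinates in A \ G for coordinates in G \ A that are at least as large. Given
    an admissible weight w, remove it from A and G and spread its mass w(A \ G)
    evenly over k = |A \ G| elements of G \ A. Averaging does not increase the
    dual norm of Lambda. What may increase is the dual norm of the given norm: the
    added part is at most phi(k) / k times the indicator of k indices, and the dual
    norm of that indicator may exceed k / phi(k) by an arbitrarily large factor.
    Here the hypothesis on delta enters: up to a fraction eta of its elements,
    every set of size k has an indicator of dual norm at most c k / phi(k), with
    c depending on eta only ([dual_dense_almost_full]). Hence the new weight, put
    on that large part, exceeds the bound L by at most c, and rescaling it costs a
    factor 1 + c / L; the greedy constant is at most (1 + c / L) / (1 - eta).

    To find such parts, norm the indicator of A, |A| = n, by a weight w
    ([norming_weights], a consequence of a finite Hahn-Banach theorem and of the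
    unconditionality of greedy bases) and take the B where w is at least a small
    multiple of phi(n) / n. It carries half of the mass, of order phi(n), so
    phi(|B|) is at least a fixed fraction of phi(n); as phi grows almost linearly
    along fixed ratios, which is what delta > 0 says, |B| is at least a fixed
    fraction of n. Repeating this in A \ B exhausts A up to any given fraction. *)

(** * Finite sums *)

Lemma big_fsetIDI (T : choiceType) (V : nmodType) (B A : {fset T}) (F : T -> V) :
  \sum_(i <- A) F i = \sum_(i <- (A `&` B)%fset) F i + \sum_(i <- (A `\` B)%fset) F i.
Proof.
rewrite (big_fsetID _ (mem B)) /=; congr (_ + _).
  by apply: eq_fbigl => i; rewrite !inE.
by apply: eq_fbigl => i; rewrite !inE andbC.
Qed.

Lemma ler_fsum_subset (T : choiceType) (R : numDomainType) (A B : {fset T}) (F : T -> R) :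
  (A `<=` B)%fset -> (forall i, 0 <= F i) -> \sum_(i <- A) F i <= \sum_(i <- B) F i.
Proof.
move=> /fsetIidPr AB F0; rewrite (@big_fsetIDI _ _ A B) AB lerDl.
exact: sumr_ge0.
Qed.

Lemma ler_fsumU (T : choiceType) (R : numDomainType) (A B : {fset T}) (F : T -> R) :
  (forall i, 0 <= F i) ->
  \sum_(i <- (A `|` B)%fset) F i <= \sum_(i <- A) F i + \sum_(i <- B) F i.
Proof.
move=> F0; rewrite (big_fsetIDI A) (fsetIidPr (fsubsetUl _ _)) lerD2l.
by apply: ler_fsum_subset => //; rewrite fsubDset.
Qed.

Lemma sum_fset_const (T : choiceType) (R : pzSemiRingType) (A : {fset T}) (c : R) :
  \sum_(i <- A) c = #|` A|%:R * c.
Proof. by rewrite big_const_seq count_predT iter_addr_0 mulr_natl. Qed.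

Lemma exists_fset_le_mean (T : choiceType) (R : realDomainType) (A : {fset T}) (F : T -> R) :
  A != fset0 -> exists2 a, a \in A & #|` A|%:R * F a <= \sum_(i <- A) F i.
Proof.
move=> /fset0Pn[a aA]; apply: contrapT => nA.
have : \sum_(i <- A | i \in A) (\sum_(j <- A) F j) <
       \sum_(i <- A | i \in A) #|` A|%:R * F i.
  apply: ltr_sum => [|i iA]; first by apply/hasP; exists a.
  by rewrite ltNge; apply/negP => le_i; apply: nA; exists i.
by rewrite -!big_seq sum_fset_const -mulr_sumr ltxx.
Qed.

(** Removing an element not above the mean does not lower the mean, so some
    subset of each smaller size has at least the mean of the whole. *)
Lemma subset_large_mean (T : choiceType) (R : realFieldType) (F : T -> R)
    (A : {fset T}) (j : nat) :
  (j <= #|` A|)%N ->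
  exists J : {fset T}, [/\ (J `<=` A)%fset, #|` J| = j &
    j%:R * \sum_(i <- A) F i <= #|` A|%:R * \sum_(i <- J) F i].
Proof.
move eqk : #|` A| => k; elim: k A eqk => [|k IH] A eqk.
  by rewrite leqn0 => /eqP ->; exists A.
rewrite leq_eqVlt => /orP[/eqP ->|]; first by exists A.
rewrite ltnS => jk.
have [a aA leA] : exists2 a, a \in A & #|` A|%:R * F a <= \sum_(i <- A) F i.
  by apply: exists_fset_le_mean; rewrite -cardfs_gt0 eqk.
have eqk' : #|` (A `\ a)%fset| = k by move: (cardfsD1 a A); rewrite aA eqk; case.
have [J [JA Jj le_J]] := IH _ eqk' jk.
exists J; split=> //; first by apply: fsubset_trans JA _; rewrite fsubD1set.
case: k jk eqk eqk' le_J {IH} => [|k] jk eqk eqk' le_J.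
  move: jk Jj; rewrite leqn0 => /eqP -> /cardfs0_eq ->.
  by rewrite big_seq_fset0 mul0r mulr0.
rewrite eqk (big_fsetD1 a) //= in leA.
rewrite (big_fsetD1 a) //=.
set S := \sum_(i <- _) F i in leA le_J *; set SJ := \sum_(i <- J) F i in le_J *.
have k0 : (0 : R) < k.+1%:R by rewrite ltr0n.
have leA' : k.+1%:R * (F a + S) <= k.+2%:R * S.
  by rewrite -(natr1 k.+1) in leA *; lra.
rewrite -(ler_pM2l k0) mulrCA (le_trans (ler_wpM2l _ leA')) ?ler0n//.
by rewrite mulrCA [leRHS]mulrCA ler_wpM2l ?ler0n.
Qed.

Lemma exists_subset_card (T : choiceType) (A : {fset T}) (j : nat) :
  (j <= #|` A|)%N -> exists2 J : {fset T}, (J `<=` A)%fset & #|` J| = j.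
Proof. by move=> /(subset_large_mean (fun=> 0 : rat))[J [? ? _]]; exists J. Qed.

Lemma cardfs_ge1 (R : numDomainType) (T : choiceType) (A : {fset T}) :
  A != fset0 -> 1 <= #|` A|%:R :> R.
Proof. by rewrite -cardfs_gt0 ler1n. Qed.

(** * A finite Hahn-Banach theorem *)

(** Hahn-Banach on the span of g_0, ..., g_n, one vector at a time. Linear forms
    are given by values f on the sequence g, which need not be independent: a
    dominated f is automatically compatible with the linear relations, since these
    are combinations of seminorm 0. *)
Lemma linear_dominated (R : realType) (V : lmodType R) (p : V -> R) (g : nat -> V) n :
  (forall x y, p (x + y) <= p x + p y) ->
  (forall (c : R) x, p (c *: x) = `|c| * p x) ->
  exists f : nat -> R, f 0%N = p (g 0%N) /\
   forall a : nat -> R,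
     \sum_(i < n.+1) a i * f i <= p (\sum_(i < n.+1) a i *: g i).
Proof.
move=> pD pZ.
have p0 : p 0 = 0 by rewrite -(scale0r 0) pZ normr0 mul0r.
have pN x : p (- x) = p x by rewrite -scaleN1r pZ normrN1 mul1r.
have pZpos c x : 0 < c -> c * p x = p (c *: x) by move=> c0; rewrite pZ gtr0_norm.
have p_ge0 x : 0 <= p x.
  have := pD x (- x); rewrite subrr p0 pN; lra.
elim: n => [|n [f [f0 fp]]].
  exists (fun=> p (g 0%N)); split=> // a; rewrite !big_ord1 pZ.
  by apply: ler_wpM2r => //; exact: ler_norm.
pose S (a : nat -> R) := \sum_(i < n.+1) a i * f i.
pose v (a : nat -> R) := \sum_(i < n.+1) a i *: g i.
have SD a b : S (fun i => a i + b i) = S a + S b.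
  by rewrite -big_split; apply: eq_bigr => i _; rewrite mulrDl.
have vD a b : v (fun i => a i + b i) = v a + v b.
  by rewrite -big_split; apply: eq_bigr => i _; rewrite scalerDl.
have SZ c a : S (fun i => c * a i) = c * S a.
  by rewrite mulr_sumr; apply: eq_bigr => i _; rewrite mulrA.
have vZ c a : v (fun i => c * a i) = c *: v a.
  by rewrite scaler_sumr; apply: eq_bigr => i _; rewrite scalerA.
(* The admissible values of f at g n.+1 form the interval between the supremum
   of E and the infimum of the p (v b + g n.+1) - S b. *)
pose E := [set r | exists a, r = S a - p (v a - g n.+1)].
have Eub b : ubound E (p (v b + g n.+1) - S b).
  move=> _ [a ->]; have := pD (v a - g n.+1) (v b + g n.+1).
  have : S (fun i => a i + b i) <= p (v (fun i => a i + b i)) := fp _.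
  rewrite SD vD addrACA [- _ + _]addrC subrr addr0; lra.
have E0 : E !=set0 by exists (S (fun=> 0) - p (v (fun=> 0) - g n.+1)), (fun=> 0).
pose t := sup E.
have tE a : S a - p (v a - g n.+1) <= t.
  by apply: ub_le_sup; [exists (p (v a + g n.+1) - S a); exact: Eub | exists a].
have Et b : t <= p (v b + g n.+1) - S b by apply: ge_sup => //; exact: Eub.
exists (fun i => if i == n.+1 then t else f i); split => // a.
rewrite big_ord_recr [X in p X]big_ord_recr /= eqxx -/(v a).
have -> : \sum_(i < n.+1) a i * (if i == n.+1 :> nat then t else f i) = S a.
  by apply: eq_bigr => i _; rewrite ltn_eqF.
set s := a n.+1.
have [s0|s0|->] := ltrgt0P s.
- have := Et (fun i => s^-1 * a i); rewrite SZ vZ -(ler_pM2l s0) mulrBr.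
  rewrite mulrA divff ?gt_eqF// mul1r (pZpos _ _ s0) scalerDr scalerA.
  rewrite divff ?gt_eqF// scale1r; lra.
- have s0' : 0 < - s by rewrite oppr_gt0.
  have := tE (fun i => (- s)^-1 * a i); rewrite SZ vZ -(ler_pM2l s0') mulrBr.
  rewrite mulrA divff ?gt_eqF// mul1r (pZpos _ _ s0') scalerDr scalerA.
  rewrite divff ?gt_eqF// scale1r scaleNr scalerN opprK; lra.
- by rewrite scale0r mul0r !addr0; exact: fp.
Qed.

(** * Growth of the fundamental function *)

(** The constant d is uniform in y, but how large x must be depends on y. *)
Lemma delta_gt0 (R : realType) (phi : R -> R) : fundamental_function phi ->
  (0 < delta phi)%E ->
  exists d : R, 0 < d <= 1 /\ forall y, 1 <= y ->
    \forall x \near +oo, d * y * phi x <= phi (y * x).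
Proof.
move=> [phi0 _ _] dp.
have [d d0 dd] : exists2 d : R, 0 < d & (d%:E < delta phi)%E.
  case: (delta phi) dp => [r||] //.
    by rewrite lte_fin => r0; exists (r / 2); rewrite ?lte_fin; lra.
  by exists 1 => //; rewrite ltry.
exists (Order.min d 1); split.
  by rewrite lt_min d0 ltr01 ge_min lexx orbT.
move=> y y1.
have : (d%:E < delta_at phi y)%E.
  by apply: lt_le_trans dd _; apply: ereal_inf_lbound; exists y.
rewrite /delta_at limf_einfE => /ereal_sup_gt[_ [A FA <-]] dA.
near=> x.
have Ax : A x by near: x.
have x1 : 1 <= x by near: x; exact: nbhs_pinfty_ge.
have : (d%:E < (phi (y * x) / (y * phi x))%:E)%E.
  by apply: lt_le_trans dA _; apply: ereal_inf_lbound; exists x.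
rewrite lte_fin => /ltW dle.
have yx0 : 0 < y * phi x by rewrite mulr_gt0 ?phi0// (lt_le_trans _ y1).
rewrite -mulrA -ler_pdivlMr//; apply: le_trans dle.
by rewrite ge_min lexx.
Unshelve. all: by end_near.
Qed.

(** * Coordinates *)

Section Coordinates.
Context {R : realType} {X : completeNormedModType R} {e : nat -> X}.
Hypothesis basis_e : schauder_basis e.

Lemma coord_expansion x : expansion e x (coord e x).
Proof.
have [a [ea _]] := basis_e x.
by apply: (@xgetPex _ (fun=> 0) [set a | expansion e x a]); exists a.
Qed.

Lemma coord_unique x a : expansion e x a -> coord e x = a.
Proof.
have [b [_ bu]] := basis_e x => ea.
by rewrite -(bu _ ea) -(bu _ (@coord_expansion x)).
Qed.

Lemma coordD x y i : coord e (x + y) i = coord e x i + coord e y i.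
Proof.
suff /(congr1 (fun a => a i)) -> : coord e (x + y) = coord e x \+ coord e y by [].
apply: coord_unique; rewrite /expansion.
suff -> : series (fun j => (coord e x \+ coord e y) j *: e j) =
    series (fun j => coord e x j *: e j) + series (fun j => coord e y j *: e j).
  exact: cvgD (@coord_expansion x) (@coord_expansion y).
apply/funext => n; rewrite /series /= -[RHS]big_split; apply: eq_bigr => j _ /=.
by rewrite scalerDl.
Qed.

Lemma coordZ c x i : coord e (c *: x) i = c * coord e x i.
Proof.
suff /(congr1 (fun a => a i)) -> : coord e (c *: x) = (fun i => c * coord e x i) by [].
apply: coord_unique; rewrite /expansion.
suff -> : series (fun j => (c * coord e x j) *: e j) =
    c \*: series (fun j => coord e x j *: e j).
  exact: cvgZr (@coord_expansion x).
apply/funext => n; rewrite /series /= scaler_sumr; apply: eq_bigr => j _ /=.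
by rewrite scalerA.
Qed.

Lemma coordB x y i : coord e (x - y) i = coord e x i - coord e y i.
Proof. by rewrite coordD -scaleN1r coordZ mulN1r. Qed.

Lemma coord_zero i : coord e 0 i = 0.
Proof. by rewrite -(scale0r 0) coordZ mul0r. Qed.

Lemma coord_sum (T : Type) (r : seq T) (F : T -> X) i :
  coord e (\sum_(j <- r) F j) i = \sum_(j <- r) coord e (F j) i.
Proof.
by elim/big_ind2: _ => [|x a y b <- <-|//]; rewrite ?coord_zero ?coordD.
Qed.

Lemma coord_basis_vector i j : coord e (e i) j = (i == j)%:R.
Proof.
suff /(congr1 (fun a => a j)) -> : coord e (e i) = (fun j => (i == j)%:R) by [].
apply: coord_unique; rewrite /expansion.
apply: cvg_near_cst; near=> n.
have ilt : (i < n)%N by near: n; exact: nbhs_infty_gt.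
rewrite /series /= big_mkord (bigD1 (Ordinal ilt)) //= eqxx scale1r big1 ?addr0//.
move=> k; rewrite -val_eqE /= eq_sym => /negbTE ->.
by rewrite scale0r.
Unshelve. all: by end_near.
Qed.

Lemma coord_fsum (A : {fset nat}) (a : nat -> R) j :
  coord e (\sum_(i <- A) a i *: e i) j = if j \in A then a j else 0.
Proof.
rewrite coord_sum; under eq_bigr do rewrite coordZ coord_basis_vector.
case: ifPn => jA.
  rewrite (big_fsetD1 j) //= eqxx mulr1 big_seq big1 ?addr0// => i.
  by rewrite !inE => /andP[/negbTE -> _]; rewrite mulr0.
rewrite big_seq big1// => i iA; case: eqP => [ij|_]; last by rewrite mulr0.
by rewrite -ij iA in jA.
Qed.

Lemma coord_partial_sum_cvg x :
  \sum_(i < n) coord e x i *: e i @[n --> \oo] --> x.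
Proof.
suff <- : series (fun i => coord e x i *: e i) =
    (fun n => \sum_(i < n) coord e x i *: e i) by exact: coord_expansion.
by apply/funext => n; rewrite /series /= big_mkord.
Qed.

Lemma sum_fset_ord (V : nmodType) (A : {fset nat}) (F : nat -> V) n :
  (forall i, i \in A -> (i < n)%N) ->
  \sum_(i <- A) F i = \sum_(i < n | val i \in A) F i.
Proof.
move=> An.
rewrite -(big_mkord (fun i => i \in A)) -[RHS]big_filter.
apply: perm_big; apply: uniq_perm; rewrite ?fset_uniq ?filter_uniq ?iota_uniq//.
move=> i; rewrite mem_filter mem_index_iota /=.
by case iA : (i \in A); rewrite //= An.
Qed.

Lemma fset_nat_bound (A : {fset nat}) : exists n, forall i, i \in A -> (i < n)%N.
Proof.
exists (\max_(i <- A) i).+1 => i iA; rewrite ltnS.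
exact: (leq_bigmax_seq i).
Qed.

End Coordinates.

(** * Unconditionality and democracy of greedy bases *)

(** As w is nonnegative and acts on absolute values of coordinates, the norming
    functionals of norm 1 are replaced by weights of norm K, where K accounts for
    the unconditionality constant of the basis. *)
Definition positively_norming {R : realType} {X : completeNormedModType R}
    (e : nat -> X) (K : R) := forall (A : {fset nat}) (c : nat -> R),
  exists w : nat -> R, [/\ forall i, 0 <= w i,
    forall (E : {fset nat}) z, \sum_(i <- E) w i * `|coord e z i| <= K * `|z| &
    `|\sum_(i <- A) c i *: e i| <= \sum_(i <- A) w i * `|c i|].

Section GreedyBases.
Context {R : realType} {X : completeNormedModType R} {e : nat -> X}.
Hypothesis basis_e : schauder_basis e.

(** A greedy sum is a coordinate projection; arguing with its support instead of
    the enumeration makes ties harmless. *)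
Lemma greedy_sum_fset (rho : X -> nat -> nat) x m : greedy_ordering e x (rho x) ->
  exists G : {fset nat}, [/\ #|` G| = m,
    greedy_sum e rho m x = \sum_(i <- G) coord e x i *: e i &
    forall i j, i \in G -> j \notin G -> `|coord e x j| <= `|coord e x i|].
Proof.
move=> [inj_rho _ rho_max].
have uniq_r : uniq (map (rho x) (iota 0 m)) by rewrite map_inj_uniq ?iota_uniq.
exists (seq_fset tt (map (rho x) (iota 0 m))); split.
- by rewrite size_seq_fset undup_id// size_map size_iota.
- rewrite /greedy_sum -(big_mkord xpredT (fun i => coord e x (rho x i) *: e (rho x i))).
  rewrite /index_iota subn0 -(big_map (rho x) xpredT (fun i => coord e x i *: e i)).
  by apply: perm_big; rewrite perm_sym; apply: uniq_perm;
    rewrite ?fset_uniq// => i; rewrite seq_fsetE.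
- move=> i j; rewrite !seq_fsetE => /mapP[k]; rewrite mem_iota /= add0n => km -> jG.
  apply: rho_max => l lk jl; case/negP: jG; rewrite jl; apply: map_f.
  by rewrite mem_iota /= add0n (leq_trans lk).
Qed.

Lemma coord_bounded (rho : X -> nat -> nat) x i : greedy_ordering e x (rho x) ->
  `|coord e x i| <= `|coord e x (rho x 0%N)|.
Proof.
move=> [_ _ rho_max]; have [->//|/eqP ne0] := eqVneq i (rho x 0%N).
by apply: rho_max => -[].
Qed.

Lemma best_error_le (N : X -> R) m x (A : {fset nat}) a : (forall y, 0 <= N y) ->
  (#|` A| <= m)%N -> best_error N e m x <= N (x - \sum_(i <- A) a i *: e i).
Proof.
move=> N0 Am; apply: ge_inf; last by exists A, a.
by exists 0 => _ [B [b [_ ->]]].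
Qed.

Lemma best_error_ge0 (N : X -> R) m x : (forall y, 0 <= N y) ->
  0 <= best_error N e m x.
Proof.
move=> N0; apply: lb_le_inf; last by move=> _ [A [a [_ ->]]].
by exists (N (x - \sum_(i <- fset0) 0 *: e i)), fset0, (fun=> 0).
Qed.

Lemma greedy_ge1 rho : greedy (fun x : X => `|x|) e rho ->
  exists C : R, 1 <= C /\ greedy_with (fun x : X => `|x|) e rho C.
Proof.
move=> [C [_ greedy_C]]; exists (Num.max C 1); split=> [|x m m0].
  by rewrite le_max lexx orbT.
apply: le_trans (greedy_C x m m0) _; rewrite ler_wpM2r ?le_max ?lexx//.
exact: (@best_error_ge0 (fun x => `|x|)).
Qed.

Context {rho : X -> nat -> nat}.
Hypothesis rho_ordering : forall x, greedy_ordering e x (rho x).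
Context {C : R}.
Hypothesis C_ge1 : 1 <= C.
Hypothesis greedy_e : greedy_with (fun x : X => `|x|) e rho C.

(** When the coordinates in B are strictly larger than the others, ties cannot
    interfere and B is the greedy set. *)
Lemma greedy_dominating y (A B : {fset nat}) a :
  (forall i j, i \in B -> j \notin B -> `|coord e y j| < `|coord e y i|) ->
  (#|` A| <= #|` B|)%N ->
  `|y - \sum_(i <- B) coord e y i *: e i| <= C * `|y - \sum_(i <- A) a i *: e i|.
Proof.
move=> domB AB.
have C0 : 0 <= C by apply: le_trans C_ge1.
have [B0|B0] := posnP #|` B|.
  move: AB; rewrite B0 leqn0 cardfs_eq0 => /eqP ->.
  move/cardfs0_eq : B0 => ->; rewrite !big_seq_fset0 subr0.
  by rewrite ler_peMl.
have [G [cG sG domG]] := greedy_sum_fset #|` B| (rho_ordering y).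
have GB : G = B.
  apply/eqP; have [GB|/fsubsetPn[j jG jB]] := boolP (G `<=` B)%fset.
    by rewrite eqEfcard GB cG /=.
  rewrite eq_sym eqEfcard cG leqnn andbT.
  apply/fsubsetP => i iB; apply: contraT => iG.
  by have := domB _ _ iB jB; rewrite ltNge domG.
rewrite -GB -sG -cG GB; apply: le_trans (greedy_e _ B0) _.
by apply: ler_wpM2l => //; apply: (@best_error_le (fun x => `|x|)).
Qed.

(** Raise the coordinates in F to a common value M above all the others. The
    greedy remainder of the resulting vector is x - P_F x, while x itself is one of
    its approximation errors. *)
Lemma suppression x (F : {fset nat}) :
  `|x - \sum_(i <- F) coord e x i *: e i| <= C * `|x|.
Proof.
pose M := `|coord e x (rho x 0%N)| + 1.
have M0 : 0 < M by rewrite ltr_wpDl.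
pose y := x + \sum_(i <- F) (M - coord e x i) *: e i.
have yE i : coord e y i = if i \in F then M else coord e x i.
  rewrite coordD// coord_fsum//; case: ifP => _; rewrite ?addr0//; lra.
have -> : x - \sum_(i <- F) coord e x i *: e i = y - \sum_(i <- F) coord e y i *: e i.
  rewrite {1}/y -addrA -sumrB -sumrN; congr (_ + _).
  rewrite !big_seq; apply: eq_bigr => i iF.
  by rewrite yE iF -scalerBl -scaleNr; congr (_ *: _); lra.
have {1}-> : x = y - \sum_(i <- F) (M - coord e x i) *: e i by rewrite /y addrK.
apply: greedy_dominating => // i j iF jF.
rewrite !yE iF (negbTE jF) (gtr0_norm M0).
by apply: le_lt_trans (coord_bounded _ (rho_ordering x)) _; rewrite ltrDl.
Qed.

Lemma projection_le x (F : {fset nat}) :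
  `|\sum_(i <- F) coord e x i *: e i| <= (1 + C) * `|x|.
Proof.
rewrite -[X in `|X|](subKr x) (le_trans (ler_normB _ _))// mulrDl mul1r.
by rewrite lerD2l suppression.
Qed.

(** The part of A inside B is a projection of the indicator of B. For the rest, A',
    apply greediness to the sum of the indicator of A' and twice that of B: the
    greedy remainder is the former, and removing A' leaves the latter. *)
Lemma democracy (A B : {fset nat}) : (#|` A| <= #|` B|)%N ->
  `|\sum_(i <- A) e i| <= (1 + 3 * C) * `|\sum_(i <- B) e i|.
Proof.
have C0 : 0 <= C by apply: le_trans C_ge1.
pose s (A : {fset nat}) := \sum_(i <- A) 1 *: e i.
have sE (A' : {fset nat}) : \sum_(i <- A') e i = s A' by apply: eq_bigr => i _; rewrite scale1r.
have sC (A' : {fset nat}) i : coord e (s A') i = if i \in A' then 1 else 0.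
  exact: coord_fsum.
move=> AB; rewrite !sE /s (big_fsetIDI B) -!/(s _).
have -> : (1 + 3 * C) * `|s B| = (1 + C) * `|s B| + C * `|2 *: s B|.
  by rewrite normrZ ger0_norm//; lra.
apply: le_trans (ler_normD _ _) _; apply: lerD.
  have <- : \sum_(i <- (A `&` B)%fset) coord e (s B) i *: e i = s (A `&` B)%fset.
    rewrite [RHS]/s !big_seq; apply: eq_bigr => i; rewrite inE => /andP[_ iB].
    by rewrite sC iB.
  exact: projection_le.
set A' := (A `\` B)%fset.
pose y := s A' + 2 *: s B.
have yE i : coord e y i = if i \in B then 2 else if i \in A' then 1 else 0.
  rewrite coordD// coordZ// !sC /A' inE.
  by case: (i \in B); rewrite ?mulr1 ?mulr0 ?addr0 ?add0r.
have -> : 2 *: s B = y - s A' by rewrite /y addrC addKr.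
have {1}-> : s A' = y - \sum_(i <- B) coord e y i *: e i.
  rewrite {1}/y [X in _ + _ - X](_ : _ = 2 *: s B) ?addrK//.
  rewrite /s scaler_sumr !big_seq; apply: eq_bigr => i iB.
  by rewrite yE iB scale1r.
apply: greedy_dominating; last first.
  by apply: leq_trans AB; rewrite fsubset_leq_card// fsubsetDl.
move=> i j iB jB; rewrite !yE iB (negbTE jB) [X in _ < X]ger0_norm//.
by case: ifP => _; rewrite ?normr1 ?normr0; lra.
Qed.

(** The weight is the absolute value of a norming functional f. Testing |f|
    against |z| amounts to testing f against the difference of the projections of z
    on the indices where f and z agree in sign and where they disagree; hence the
    factor 2. *)
Lemma norming_weights : positively_norming e (2 * (1 + C)).
Proof.
move=> A c; have [n An] := fset_nat_bound A.
pose x := \sum_(i <- A) c i *: e i.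
(* Position 0 of g holds the vector to be normed, so e i sits at i.+1. *)
pose g i := if i is i'.+1 then e i' else x.
have [f [f0 fp]] := @linear_dominated R X (fun x => `|x|) g n
  (@ler_normD _ _) (@normrZ _ _).
have fA (E : {fset nat}) a : (forall i, i \in E -> (i < n)%N) ->
    \sum_(i <- E) a i * f i.+1 <= `|\sum_(i <- E) a i *: e i|.
  move=> En; rewrite !(sum_fset_ord _ En) big_mkcond [X in `|X|]big_mkcond /=.
  have := fp (fun i => if i is i'.+1 then (if i' \in E then a i' else 0) else 0).
  rewrite !big_ord_recl /= mul0r scale0r !add0r => le_f.
  apply: le_trans (le_trans le_f _); rewrite le_eqVlt; apply/orP; left; apply/eqP;
    [|congr `|_|]; apply: eq_bigr => i _; rewrite /bump /= ?add1n;
    by case: ifP; rewrite ?mul0r ?scale0r.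
exists (fun i => if (i < n)%N then `|f i.+1| else 0); split.
- by move=> i; case: ifP.
- move=> E z.
  have -> : \sum_(i <- E) (if (i < n)%N then `|f i.+1| else 0) * `|coord e z i| =
      \sum_(i <- [fset i in E | (i < n)%N]%fset) `|coord e z i * f i.+1|.
    rewrite -big_fset_condE /= [RHS]big_mkcond; apply: eq_bigr => i _.
    by case: ifP; rewrite ?mul0r// normrM mulrC.
  rewrite (big_fsetID _ (fun i => 0 <= coord e z i * f i.+1)) /=.
  have -> : 2 * (1 + C) * `|z| = (1 + C) * `|z| + (1 + C) * `|z| by lra.
  apply: lerD.
    set E' := (X in \sum_(i <- X) _).
    rewrite (le_trans _ (projection_le _ E'))//.
    apply: le_trans (fA _ _ _); last by move=> i; rewrite !inE => /andP[/andP[]].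
    rewrite !big_seq; apply: ler_sum => i; rewrite !inE => /andP[_ i0].
    by rewrite ger0_norm.
  set E' := (X in \sum_(i <- X) _).
  rewrite (le_trans _ (projection_le _ E'))//.
  rewrite -normrN -sumrN; under [X in `|X|]eq_bigr do rewrite -scaleNr.
  apply: le_trans (fA _ _ _); last by move=> i; rewrite !inE => /andP[/andP[]].
  rewrite !big_seq; apply: ler_sum => i; rewrite !inE -ltNge => /andP[_ i0].
  by rewrite ltr0_norm// mulNr.
- have := fp (fun i => if i is i'.+1 then (if i' \in A then - c i' else 0) else 1).
  rewrite !big_ord_recl /= scale1r mul1r f0 /=.
  have -> : x + \sum_(i < n) (if bump 0 i is i'.+1
      then if i' \in A then - c i' else 0 else 1) *: g (bump 0 i) = 0.
    rewrite /x (sum_fset_ord _ An) big_mkcond -big_split big1 //= => i _.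
    by rewrite /bump /= ?add1n /=; case: ifP; rewrite ?scale0r ?addr0// scaleNr subrr.
  rewrite normr0 => le0; apply: (@le_trans _ _ (\sum_(i <- A) c i * f i.+1)).
    rewrite -subr_le0; apply: le_trans le0; rewrite lerD2l.
    rewrite (sum_fset_ord _ An) -sumrN big_mkcond; apply: ler_sum => i _.
    by rewrite /bump /= ?add1n /=; case: ifP; rewrite ?mul0r// mulNr.
  rewrite !big_seq; apply: ler_sum => i iA.
  by rewrite An// -normrM mulrC ler_norm.
Qed.

End GreedyBases.

(** * The fundamental function *)

Section FundamentalBounds.
Context {R : realType} {X : completeNormedModType R} {e : nat -> X} {phi : R -> R}.
Hypothesis seminormalized_e : seminormalized (fun x : X => `|x|) e.
Hypothesis phi_for : fundamental_function_for (fun x : X => `|x|) e phi.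

Lemma seminormalizedP : exists c M : R, 0 < c /\ forall i, c <= `|e i| <= M.
Proof.
have [inf_gt0 sup_lt] := seminormalized_e.
set s := ereal_sup _ in sup_lt; set l := ereal_inf _ in inf_gt0.
have sE i : (`|e i|%:E <= s)%E by apply: ereal_sup_ubound; exists i.
have lE i : (l <= `|e i|%:E)%E by apply: ereal_inf_lbound; exists i.
case: s sup_lt sE => [M||] // _ sE; last by have := sE 0%N; rewrite leeNy_eq.
case: l inf_gt0 lE => [c||] // c0 lE; last by have := lE 0%N; rewrite leye_eq.
exists c, M; split=> [|i]; first by rewrite lte_fin in c0.
by have := lE i; have := sE i; rewrite !lee_fin => -> ->.
Qed.

Lemma norm_le_fundamental (A : {fset nat}) : A != fset0 ->
  `|\sum_(i <- A) e i| <= phi #|` A|%:R.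
Proof.
rewrite -cardfs_gt0 => A0; rewrite phi_for.2//.
apply: ub_le_sup; last by exists A.
have [c [M [c0 cM]]] := seminormalizedP.
exists (#|` A|%:R * M) => _ [B [BA ->]].
apply: le_trans (ler_norm_sum _ _ _) _.
apply: (@le_trans _ _ (\sum_(i <- B) M)).
  by apply: ler_sum => i _; have /andP[] := cM i.
rewrite sum_fset_const ler_wpM2r ?ler_nat//.
by have /andP[le1 le2] := cM 0%N; apply: le_trans (ltW c0) (le_trans le1 le2).
Qed.

Lemma fundamental_le_norm (D : R) (B : {fset nat}) : B != fset0 ->
  (forall A : {fset nat}, (#|` A| <= #|` B|)%N ->
    `|\sum_(i <- A) e i| <= D * `|\sum_(i <- B) e i|) ->
  phi #|` B|%:R <= D * `|\sum_(i <- B) e i|.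
Proof.
rewrite -cardfs_gt0 => B0 dem; rewrite phi_for.2//; apply: ge_sup.
  by exists `|\sum_(i <- B) e i|, B.
by move=> _ [A [/dem ? ->]].
Qed.

End FundamentalBounds.

(** * Large subsets with small dual norm *)

(** The last condition bounds the dual norm of the indicator of B. With B = A this
    would be bidemocracy, which a greedy basis need not have. *)
Definition dual_dense {R : realType} {X : completeNormedModType R}
    (e : nat -> X) (phi : R -> R) (th c : R) := forall A : {fset nat}, A != fset0 ->
  exists B : {fset nat}, [/\ (B `<=` A)%fset, th * #|` A|%:R <= #|` B|%:R &
    forall z, phi #|` A|%:R / #|` A|%:R * \sum_(i <- B) `|coord e z i| <= c * `|z|].

Section DualDensity.
Context {R : realType} {X : completeNormedModType R} {e : nat -> X} {phi : R -> R}.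
Hypothesis basis_e : schauder_basis e.
Hypothesis phi_fundamental : fundamental_function phi.

Let phi_gt0 x : 1 <= x -> 0 < phi x. Proof. by case: phi_fundamental => + _ _; apply. Qed.
Let phi_le x y : 1 <= x -> x <= y -> phi x <= phi y.
Proof. by case: phi_fundamental => _ + _; apply. Qed.
Let phi_div_le x y : 1 <= x -> x <= y -> phi y / y <= phi x / x.
Proof. by case: phi_fundamental => _ _; apply. Qed.

Context {D K b : R}.
Hypothesis D_ge1 : 1 <= D.
Hypothesis K_ge1 : 1 <= K.
Hypothesis norm_le_phi : forall A : {fset nat}, A != fset0 ->
  `|\sum_(i <- A) e i| <= phi #|` A|%:R.
Hypothesis phi_le_norm : forall A : {fset nat}, A != fset0 ->
  phi #|` A|%:R <= D * `|\sum_(i <- A) e i|.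
Hypothesis norming : positively_norming e K.
Hypothesis coord_le : forall z i, `|coord e z i| <= b * `|z|.

Lemma weight_le_fundamental (w : nat -> R) (E : {fset nat}) :
  (forall z, \sum_(i <- E) w i * `|coord e z i| <= K * `|z|) ->
  E != fset0 -> \sum_(i <- E) w i <= K * phi #|` E|%:R.
Proof.
move=> /(_ (\sum_(i <- E) 1 *: e i)) le_w E0.
apply: (@le_trans _ _ (K * `|\sum_(i <- E) 1 *: e i|)).
  apply: le_trans le_w; rewrite big_seq [leRHS]big_seq; apply: ler_sum => i iE.
  by rewrite coord_fsum// iE normr1 mulr1.
rewrite ler_wpM2l ?(le_trans _ K_ge1)//.
by under eq_bigr do rewrite scale1r; exact: norm_le_phi.
Qed.

Local Notation dual_dense := (dual_dense e phi).

(** B is the set where a weight norming the indicator of A is at least a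
    threshold t, so that the dual norm of the indicator of B is at most K / t. For
    A so small that the growth of phi gives no information, B = A will do, with a
    constant that depends on the threshold x0 of the growth condition. *)
Lemma dual_dense_of_growth (d : R) : 0 < d <= 1 ->
  (forall y, 1 <= y -> \forall x \near +oo, d * y * phi x <= phi (y * x)) ->
  exists th c : R, [/\ 0 < th <= 1, 0 <= c & dual_dense th c].
Proof.
move=> /andP[d0 d1] dphi.
have D0 : 0 < D by apply: lt_le_trans D_ge1.
have K0 : 0 < K by apply: lt_le_trans K_ge1.
have b0 : 0 <= b * `|e 0%N| by apply: le_trans (coord_le _ 0%N).
(* The factor 4 leaves room for the half of the mass of w that lies below t. *)
pose y := 4 * D * K / d.
have dy : d * y = 4 * D * K by rewrite /y mulrC divfK ?gt_eqF.
have y1 : 1 <= y.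
  rewrite /y ler_pdivlMr// mul1r (le_trans d1)// -mulrA (@le_trans _ _ 4)//.
    by lra.
  by rewrite ler_peMr// mulr_ege1.
have y0 : 0 < y by apply: lt_le_trans y1.
have [M [_ phiM]] := dphi _ y1.
pose x0 := Num.max M 1; pose c0 := phi 1 * (y * x0) * `|b|.
exists y^-1, (2 * D * K + c0).
have x01 : 1 <= x0 by rewrite le_max lexx orbT.
have c00 : 0 <= c0.
  have x00 : 0 < x0 by exact: lt_le_trans x01.
  apply: mulr_ge0 => //; apply: mulr_ge0; first exact/ltW/phi_gt0.
  by apply: mulr_ge0; exact: ltW.
have DK0 : 0 <= 2 * D * K by rewrite !mulr_ge0// ltW.
split; first by rewrite invr_gt0 y0 invf_le1.
  exact: addr_ge0.
move=> A A0; set n := #|` A|%:R.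
have n1 : 1 <= n := cardfs_ge1 _ A0.
have n0 : 0 < n by apply: lt_le_trans n1.
have pn0 : 0 < phi n := phi_gt0 n1.
have [small|large] := leP (y^-1 * n) x0.
  exists A; split=> [//|| z]; first by rewrite ler_piMl ?invf_le1// ltW.
  apply: (@le_trans _ _ (c0 * `|z|)); last by rewrite ler_wpM2r// lerDr.
  have -> : c0 * `|z| = phi 1 * (y * x0 * (`|b| * `|z|)) by rewrite /c0 !mulrA.
  apply: ler_pM.
  - by rewrite divr_ge0// ltW.
  - exact: sumr_ge0.
  - by have := phi_div_le (lexx 1) n1; rewrite divr1.
  apply: (@le_trans _ _ (\sum_(i <- A) (`|b| * `|z|))).
    apply: ler_sum => i _; apply: le_trans (coord_le _ _) _.
    by rewrite ler_wpM2r// ler_norm.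
  rewrite sum_fset_const ler_wpM2r ?mulr_ge0//.
  by rewrite -ler_pdivrMl.
have [w [w0 wK wA]] := norming A (fun=> 1).
have {}wA : phi n <= D * \sum_(i <- A) w i.
  apply: le_trans (phi_le_norm A0) _; rewrite ler_pM2l//.
  under eq_bigr do rewrite -[e _]scale1r.
  apply: le_trans wA _; rewrite le_eqVlt; apply/orP; left; apply/eqP.
  by apply: eq_bigr => i _; rewrite normr1 mulr1.
pose t := phi n / (2 * D * n).
have t0 : 0 < t by rewrite divr_gt0// !mulr_gt0.
have tn : D * (n * t) = phi n / 2.
  by rewrite /t; field; rewrite !gt_eqF.
pose B := [fset i in A | t <= w i]%fset.
have BA : (B `<=` A)%fset by apply/fsubsetP => i; rewrite !inE => /andP[].
have wB : phi n / 2 <= D * \sum_(i <- B) w i.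
  have wAB : \sum_(i <- (A `\` B)%fset) w i <= n * t.
    apply: (@le_trans _ _ (\sum_(i <- (A `\` B)%fset) t)).
      rewrite !big_seq; apply: ler_sum => i; rewrite !inE => /andP[+ iA].
      by rewrite iA /= -ltNge => /ltW.
    rewrite sum_fset_const ler_pM2r// ler_nat.
    by rewrite fsubset_leq_card// fsubsetDl.
  move: wA; rewrite (big_fsetIDI B) (fsetIidPr BA) mulrDr => wA.
  have := ler_wpM2l (ltW D0) wAB; rewrite tn; lra.
have B0 : B != fset0.
  apply/eqP => B0; move: wB; rewrite B0 big_seq_fset0 mulr0; lra.
have leB : D * \sum_(i <- B) w i <= D * (K * phi #|` B|%:R).
  by rewrite ler_pM2l//; apply: weight_le_fundamental.
exists B; split=> [//|| z].
  rewrite leNgt; apply/negP => ltB.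
  have x1 : 1 <= y^-1 * n by apply: le_trans x01 (ltW large).
  have xM : M < y^-1 * n by apply: le_lt_trans large; rewrite le_max lexx.
  have := phiM _ xM; rewrite /= dy mulVKf ?gt_eqF// => le_phi.
  have phiB := phi_le (cardfs_ge1 _ B0) (ltW ltB).
  have : D * (K * phi #|` B|%:R) <= D * (K * phi (y^-1 * n)) by rewrite !ler_pM2l.
  have -> : D * (K * phi (y^-1 * n)) = 4 * D * K * phi (y^-1 * n) / 4.
    by field.
  lra.
apply: (@le_trans _ _ (2 * D * K * `|z|)); last by rewrite ler_wpM2r// lerDl.
have -> : phi n / n = 2 * D * t by rewrite /t; field; rewrite !gt_eqF.
clearbody t; rewrite -!mulrA !ler_pM2l// (le_trans _ (wK B z))// mulr_sumr !big_seq.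
apply: ler_sum => i; rewrite !inE => /andP[_ ti].
by rewrite ler_wpM2r.
Qed.

(** Apply density in the rest A \ B of each step; phi(n) / n decreases, so the
    bound relative to the smaller set A \ B is stronger than the one relative to
    A. *)
Lemma dual_dense_iter th c j : 0 < th <= 1 -> 0 <= c -> dual_dense th c ->
  dual_dense (1 - (1 - th) ^+ j) (j%:R * c).
Proof.
move=> /andP[th0 th1] c0 thc; elim: j => [|j IH] A A0.
  exists fset0; rewrite expr0 subrr mul0r; split=> // z.
  by rewrite big_seq_fset0 mulr0 mul0r mul0r.
have [B [BA cB leB]] := IH _ A0.
set n : R := #|` A|%:R in cB leB *.
have cA' (B' : {fset nat}) : (B' `<=` A)%fset -> #|` (A `\` B')%fset|%:R = n - #|` B'|%:R :> R.
  by move=> B'A; rewrite cardfsD (fsetIidPr B'A) natrB// fsubset_leq_card.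
have [A'0|A'0] := eqVneq (A `\` B)%fset fset0.
  exists B; split=> // [|z].
    have := cA' _ BA; rewrite A'0 cardfs0 => /esym/eqP; rewrite subr_eq0 => /eqP <-.
    rewrite ler_piMl// gerBl exprn_ge0// subr_ge0//.
  by apply: le_trans (leB z) _; rewrite ler_wpM2r// ler_wpM2r// ler_nat.
have [B' [B'A cB' leB']] := thc _ A'0.
have B'sub : (B' `<=` A)%fset by apply: fsubset_trans B'A _; exact: fsubsetDl.
have cU : #|` (B `|` B')%fset| = (#|` B| + #|` B'|)%N.
  suff /eqP BB' : (B `&` B')%fset == fset0 by rewrite -cardfsUI BB' cardfs0 addn0.
  rewrite fsetI_eq0; apply/fdisjointP => i iB.
  by apply/negP => /(fsubsetP B'A); rewrite inE iB.
have UA : (B `|` B' `<=` A)%fset by rewrite fsubUset BA.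
exists (B `|` B')%fset; split=> // [|z].
  rewrite cU natrD.
  have := cA' _ BA; rewrite cA'// in cB' *.
  move: cB'; rewrite exprSr => cB' _.
  have th1' : 0 <= 1 - th by rewrite subr_ge0.
  have := ler_wpM2l th1' cB; rewrite -/n; nra.
apply: (@le_trans _ _ (j%:R * c * `|z| + c * `|z|)); last first.
  by rewrite -natr1 -mulrDl -[X in _ + X]mul1r -mulrDl.
apply: le_trans (ler_wpM2l _ (ler_fsumU B B' (fun i => normr_ge0 _))) _.
  by rewrite divr_ge0// ltW// phi_gt0// cardfs_ge1.
rewrite mulrDr lerD//; apply: le_trans (leB' z).
rewrite ler_wpM2r ?sumr_ge0//; apply: phi_div_le; first exact: cardfs_ge1.
by rewrite ler_nat fsubset_leq_card// fsubsetDl.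
Qed.

Lemma dual_dense_almost_full (d eta : R) : 0 < d <= 1 ->
  (forall y, 1 <= y -> \forall x \near +oo, d * y * phi x <= phi (y * x)) ->
  0 < eta -> exists c : R, 0 <= c /\ dual_dense (1 - eta) c.
Proof.
move=> d01 dphi eta0.
have [th [c [th01 c0 thc]]] := dual_dense_of_growth d01 dphi.
have /andP[th0 th1] := th01.
have [n _ nP] : \forall n \near \oo, `|(1 - th) ^+ n| < eta.
  have : (fun n => (1 - th) ^+ n) @ \oo --> (0 : R).
    by apply: cvg_expr; rewrite ger0_norm; lra.
  by move=> /cvgr0Pnorm_lt; apply.
exists (n%:R * c); split; first by rewrite mulr_ge0.
move=> A A0; have [B [BA cB leB]] := dual_dense_iter n th01 c0 thc A0.
exists B; split=> //; apply: le_trans cB; rewrite ler_wpM2r// lerD2l lerN2.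
by apply: le_trans (ler_norm _) (ltW _); apply: nP => /=.
Qed.

End DualDensity.

(** * The truncated Lorentz norm *)

(** The empty set is excluded because phi is only controlled on [1, +oo[. *)
Definition bounded_weight {R : realType} {X : completeNormedModType R}
    (e : nat -> X) (phi : R -> R) (L : R) (w : nat -> R) :=
  [/\ forall i, 0 <= w i,
      forall E : {fset nat}, E != fset0 -> \sum_(i <- E) w i <= phi #|` E|%:R &
      forall (E : {fset nat}) z, \sum_(i <- E) w i * `|coord e z i| <= L * `|z|].

Definition truncated_lorentz {R : realType} {X : completeNormedModType R}
    (e : nat -> X) (phi : R -> R) (L : R) (x : X) : R :=
  sup [set r | exists (w : nat -> R) (E : {fset nat}),
    bounded_weight e phi L w /\ r = \sum_(i <- E) w i * `|coord e x i|].

Section TruncatedLorentz.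
Context {R : realType} {X : completeNormedModType R} {e : nat -> X} {phi : R -> R}.
Hypothesis basis_e : schauder_basis e.
Hypothesis phi_fundamental : fundamental_function phi.

Let phi_gt0 x : 1 <= x -> 0 < phi x. Proof. by case: phi_fundamental => + _ _; apply. Qed.
Let phi_le x y : 1 <= x -> x <= y -> phi x <= phi y.
Proof. by case: phi_fundamental => _ + _; apply. Qed.

Context {L : R}.
Hypothesis L_ge1 : 1 <= L.
Let L_ge0 : 0 <= L. Proof. exact: le_trans L_ge1. Qed.

Local Notation bw := (bounded_weight e phi L).
Local Notation T := (truncated_lorentz e phi L).

Lemma bounded_weight0 : bw (fun=> 0).
Proof.
split=> // [E E0|E z].
  by rewrite big1// ltW// phi_gt0// cardfs_ge1.
by rewrite big1 ?mulr_ge0// => i _; rewrite mul0r.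
Qed.

Lemma bounded_weight_le w (E : {fset nat}) x : bw w -> \sum_(i <- E) w i * `|coord e x i| <= T x.
Proof.
move=> bww; apply: ub_le_sup; last by exists w, E.
by exists (L * `|x|) => _ [w' [E' [[_ _ le_w'] ->]]].
Qed.

Lemma truncated_lorentz_le x r :
  (forall w (E : {fset nat}), bw w -> \sum_(i <- E) w i * `|coord e x i| <= r) -> T x <= r.
Proof.
move=> le_r; apply: ge_sup.
  by exists (\sum_(i <- fset0) 0 * `|coord e x i|), (fun=> 0), fset0; split=> //;
    exact: bounded_weight0.
by move=> _ [w [E [bww ->]]]; exact: le_r.
Qed.

Lemma truncated_lorentz_ge0 x : 0 <= T x.
Proof. by have := bounded_weight_le fset0 x bounded_weight0; rewrite big_seq_fset0. Qed.

Lemma truncated_lorentz_le_norm x : T x <= L * `|x|.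
Proof. by apply: truncated_lorentz_le => w E [_ _]; apply. Qed.

Lemma truncated_lorentz_mono x y :
  (forall i, `|coord e x i| <= `|coord e y i|) -> T x <= T y.
Proof.
move=> xy; apply: truncated_lorentz_le => w E bww.
apply: le_trans (bounded_weight_le E y bww); apply: ler_sum => i _.
by rewrite ler_wpM2l//; case: bww.
Qed.

Lemma truncated_lorentzD x y : T (x + y) <= T x + T y.
Proof.
apply: truncated_lorentz_le => w E bww.
apply: le_trans (lerD (bounded_weight_le E x bww) (bounded_weight_le E y bww)).
rewrite -big_split; apply: ler_sum => i _ /=; rewrite coordD// -mulrDr.
by rewrite ler_wpM2l ?ler_normD//; case: bww.
Qed.

Lemma truncated_lorentzZ c x : T (c *: x) = `|c| * T x.
Proof.
have le_c d y : T (d *: y) <= `|d| * T y.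
  apply: truncated_lorentz_le => w E bww.
  rewrite (le_trans _ (ler_wpM2l _ (bounded_weight_le E y bww)))// mulr_sumr.
  by apply: ler_sum => i _; rewrite coordZ// normrM mulrCA.
apply/eqP; rewrite eq_le le_c /=.
have [->|c0] := eqVneq c 0; first by rewrite normr0 mul0r truncated_lorentz_ge0.
have := le_c c^-1 (c *: x); rewrite scalerA mulVf// scale1r normfV.
by rewrite -ler_pdivrMl ?invr_gt0 ?normr_gt0// invrK.
Qed.

(** A norming weight of a partial sum of x, divided by K, is bounded. *)
Lemma norm_le_truncated_lorentz (K : R) x : 1 <= K ->
  (forall A : {fset nat}, A != fset0 -> `|\sum_(i <- A) e i| <= phi #|` A|%:R) ->
  positively_norming e K ->
  `|x| <= K * T x.
Proof.
move=> K1 norm_le_phi norming; have K0 : 0 < K by apply: lt_le_trans K1.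
have le_n n : `|\sum_(i < n) coord e x i *: e i| <= K * T x.
  pose A := seq_fset tt (iota 0 n).
  have AE i : (i \in A) = (i < n)%N by rewrite seq_fsetE mem_iota.
  have sA : \sum_(i <- A) coord e x i *: e i = \sum_(i < n) coord e x i *: e i.
    rewrite (@sum_fset_ord _ _ _ n) => [|i]; last by rewrite AE.
    by apply: eq_bigl => i; rewrite AE ltn_ord.
  have [w [w0 wK wA]] := norming A (coord e x).
  rewrite -sA (le_trans wA)// -ler_pdivrMl// mulr_sumr.
  have bww : bw (fun i => K^-1 * w i).
    split=> [i|E E0|E z].
    - by rewrite mulr_ge0 ?invr_ge0// ltW.
    - by rewrite -mulr_sumr ler_pdivrMl// (weight_le_fundamental basis_e K1 norm_le_phi).
    - under eq_bigr do rewrite -mulrA.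
      by rewrite -mulr_sumr ler_pdivrMl// (le_trans (wK E z))// ler_wpM2l ?ler_peMl// ltW.
  by under eq_bigr do rewrite mulrA; exact: bounded_weight_le.
have : `|\sum_(i < n) coord e x i *: e i| @[n --> \oo] --> `|x|.
  by apply: cvg_norm; exact: coord_partial_sum_cvg.
move=> cvg_x; rewrite -(cvg_lim _ cvg_x)//; apply: limr_le; first by apply: cvgP cvg_x.
by apply: nearW => n; exact: le_n.
Qed.

(** The lower bound uses the weight phi(1) carried by the single index i; the
    second hypothesis says that L is large enough for it to be bounded. *)
Lemma truncated_lorentz_basis (b : R) i :
  (forall z j, `|coord e z j| <= b * `|z|) -> phi 1 * b <= L -> T (e i) = phi 1.
Proof.
move=> coord_le Lb.
have phi1 : 0 < phi 1 by exact: phi_gt0.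
apply/eqP; rewrite eq_le; apply/andP; split.
  apply: truncated_lorentz_le => w E [w0 wphi _].
  under eq_bigr do rewrite (coord_basis_vector basis_e).
  have [iE|iE] := boolP (i \in E).
    rewrite (big_fsetD1 i)//= eqxx normr1 mulr1 big_seq big1 ?addr0.
      have := wphi [fset i]%fset; rewrite big_seq_fset1 cardfs1; apply.
      by rewrite -cardfs_gt0 cardfs1.
    by move=> j; rewrite !inE eq_sym => /andP[/negbTE -> _]; rewrite normr0 mulr0.
  rewrite big_seq big1 ?ltW// => j jE; case: eqP => [ij|_]; last by rewrite normr0 mulr0.
  by rewrite ij jE in iE.
have bww : bw (fun j => if j == i then phi 1 else 0).
  have sumE (E : {fset nat}) (F : nat -> R) : \sum_(j <- E) (if j == i then phi 1 else 0) * F j =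
      if i \in E then phi 1 * F i else 0.
    case: ifPn => iE.
      rewrite (big_fsetD1 i)//= eqxx big_seq big1 ?addr0// => j.
      by rewrite !inE => /andP[/negbTE -> _]; rewrite mul0r.
    rewrite big_seq big1// => j jE; case: eqP => [ji|_]; last by rewrite mul0r.
    by rewrite -ji jE in iE.
  split=> [j|E E0|E z].
  - by case: ifP => // _; exact: ltW.
  - rewrite (eq_bigr (fun j => (if j == i then phi 1 else 0) * 1)); last first.
      by move=> j _; rewrite mulr1.
    rewrite (sumE _ (fun=> 1)) mulr1.
    by case: ifP => _; [apply: phi_le => //; exact: cardfs_ge1
                       | rewrite ltW// phi_gt0// cardfs_ge1].
  - rewrite sumE; case: ifP => _; last by rewrite mulr_ge0.
    apply: le_trans (ler_wpM2l (ltW phi1) (coord_le _ _)) _.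
    by rewrite mulrA ler_wpM2r.
have := bounded_weight_le [fset i]%fset (e i) bww.
by rewrite big_seq_fset1 (coord_basis_vector basis_e) !eqxx normr1 mulr1.
Qed.

(** Every bounded weight w for the greedy remainder is converted into a weight w'
    for the other error: w' vanishes on A and G, except that on G2, a large part of
    G \ A with small dual norm, it takes the mean value r of w over A \ G. *)
Lemma truncated_lorentz_exchange (eta c : R) x (G A : {fset nat}) (a : nat -> R) :
  0 <= c -> 0 <= eta < 1 -> dual_dense e phi (1 - eta) c -> (#|` A| <= #|` G|)%N ->
  (forall i j, i \in G -> j \notin G -> `|coord e x j| <= `|coord e x i|) ->
  (1 - eta) * T (x - \sum_(i <- G) coord e x i *: e i) <=
  (1 + c / L) * T (x - \sum_(i <- A) a i *: e i).
Proof.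
move=> c0 /andP[eta0 eta1] dense cardAG domG.
have L0 : 0 < L by exact: lt_le_trans L_ge1.
set q := 1 + c / L; have q1 : 1 <= q by rewrite lerDl divr_ge0.
have q0 : 0 < q by exact: lt_le_trans q1.
set u := x - _; set v := x - _.
have uE i : coord e u i = if i \in G then 0 else coord e x i.
  by rewrite coordB// coord_fsum//; case: ifP; rewrite ?subrr ?subr0.
have vE i : i \notin A -> coord e v i = coord e x i.
  by move=> /negbTE iA; rewrite coordB// coord_fsum// iA subr0.
clearbody u v.
pose A1 := (A `\` G)%fset.
have [A10|A10] := eqVneq A1 fset0.
  have AsubG : (A `<=` G)%fset by rewrite -fsetD_eq0 -/A1 A10.
  apply: (@le_trans _ _ (1 * T u)).
    by rewrite ler_wpM2r ?truncated_lorentz_ge0// gerBl.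
  apply: ler_pM => //; first exact: truncated_lorentz_ge0.
  apply: truncated_lorentz_mono => i; rewrite uE.
  case: ifPn => iG; first by rewrite normr0.
  by rewrite vE//; apply: contra iG; exact: (fsubsetP AsubG).
set k := #|` A1|.
have k1 : 1 <= k%:R :> R := cardfs_ge1 _ A10.
have k0 : 0 < k%:R :> R by exact: lt_le_trans k1.
have [G1 G1sub cG1] : exists2 J : {fset nat}, (J `<=` G `\` A)%fset & #|` J| = k.
  by apply: exists_subset_card; rewrite /k !cardfsD [(G `&` A)%fset]fsetIC leq_sub2r.
have G10 : G1 != fset0 by rewrite -cardfs_gt0 cG1 cardfs_gt0.
have [G2 [G2sub]] := dense _ G10; rewrite cG1 => cG2 G2dual.
have G2G i : i \in G2 -> i \in G.
  by move=> /(fsubsetP G2sub)/(fsubsetP G1sub); rewrite inE => /andP[].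
have G2A i : i \in G2 -> i \notin A.
  by move=> /(fsubsetP G2sub)/(fsubsetP G1sub); rewrite inE => /andP[].
(* The level t separates the coordinates in A1 from those in G. *)
pose t : R := \big[Num.max/0]_(i <- A1) `|coord e x i|.
have t0 : 0 <= t by rewrite /t; elim/big_ind : _ => // r s r0 s0; rewrite le_max r0.
have tA i : i \in A1 -> `|coord e x i| <= t by move=> iA; rewrite /t (le_bigmax_seq _ i).
have tG i : i \in G -> t <= `|coord e x i|.
  move=> iG; rewrite /t big_seq; apply: bigmax_le => // j; rewrite inE => /andP[jG _].
  exact: domG.
clearbody t.
rewrite -ler_pdivlMl ?subr_gt0//.
apply: truncated_lorentz_le => w E [w0 wphi wdual].
rewrite ler_pdivlMl ?subr_gt0//.
pose AG := (A `|` G)%fset; pose s := \sum_(i <- A1) w i.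
have s0 : 0 <= s by exact: sumr_ge0.
pose r := s / k%:R.
have r0 : 0 <= r by rewrite divr_ge0.
have rk : r <= phi k%:R / k%:R by rewrite ler_pM2r ?invr_gt0//; exact: wphi.
have le_u : \sum_(i <- E) w i * `|coord e u i| <=
    \sum_(i <- (E `\` AG)%fset) w i * `|coord e x i| + t * s.
  rewrite (big_fsetIDI AG) addrC; apply: lerD.
    rewrite le_eqVlt; apply/orP; left; apply/eqP; rewrite !big_seq.
    by apply: eq_bigr => i; rewrite !inE negb_or uE => /andP[/andP[_ /negbTE ->]].
  apply: (@le_trans _ _ (\sum_(i <- AG) w i * `|coord e u i|)).
    by apply: ler_fsum_subset => [|i]; [exact: fsubsetIr | rewrite mulr_ge0].
  rewrite -(@big_fset_incl _ _ _ _ A1); last 2 first.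
  - by apply: fsubset_trans (fsubsetDl _ _) (fsubsetUl _ _).
  - move=> i; rewrite /AG /A1 !inE uE => /orP[->|->]; last by rewrite normr0 mulr0.
    by rewrite andbT negbK => ->; rewrite normr0 mulr0.
  rewrite mulr_sumr !big_seq; apply: ler_sum => i iA1.
  rewrite [t * _]mulrC ler_wpM2l// uE; case: ifP => _; first by rewrite normr0.
  exact: tA.
pose w' i := if i \in G2 then r else if i \in AG then 0 else w i.
have w'0 i : 0 <= w' i by rewrite /w'; case: ifP => // _; case: ifP.
have sum_w' (F : {fset nat}) (g : nat -> R) : (forall i, 0 <= g i) ->
    \sum_(i <- F) w' i * g i =
    r * \sum_(i <- (F `&` G2)%fset) g i + \sum_(i <- (F `\` (G2 `|` AG))%fset) w i * g i.
  move=> g0; rewrite (big_fsetIDI G2) mulr_sumr; congr (_ + _).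
    by rewrite !big_seq; apply: eq_bigr => i; rewrite inE /w' => /andP[_ ->].
  rewrite (big_fsetIDI AG) big1_seq ?add0r.
    rewrite fsetDDl !big_seq; apply: eq_bigr => i; rewrite inE in_fsetU negb_or /w'.
    by move=> /andP[/andP[/negbTE -> /negbTE ->]].
  move=> i /andP[_]; rewrite !in_fsetE /w' => /andP[/andP[/negbTE -> _]].
  by rewrite /AG !in_fsetE => ->; rewrite mul0r.
have bww' : bw (fun i => q^-1 * w' i).
  split=> [i|F F0|F z].
  - by rewrite mulr_ge0 ?invr_ge0 ?(ltW q0).
  - rewrite -mulr_sumr ler_pdivrMl//.
    apply: (@le_trans _ _ (phi #|` F|%:R)); last first.
      by rewrite ler_peMl// ltW// phi_gt0// cardfs_ge1.
    have := sum_w' F (fun=> 1) (fun=> ler01).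
    under eq_bigr do rewrite mulr1.
    under [in X in _ = _ + X]eq_bigr do rewrite mulr1.
    rewrite sum_fset_const mulr1 => ->; set j := #|` _|; set H := (F `\` _)%fset.
    have jk : (j <= k)%N.
      rewrite -cG1; apply: leq_trans (fsubset_leq_card G2sub).
      by apply: fsubset_leq_card; exact: fsubsetIr.
    (* The mass of w' on F inside G2 is at most that of w on a subset J of A1 of
       the same size; so on F it is at most the mass of w on J and H, whose union
       has at most as many elements as F. *)
    have [J [JA1 cJ le_J]] := subset_large_mean w jk.
    have JH : \sum_(i <- (J `|` H)%fset) w i = \sum_(i <- J) w i + \sum_(i <- H) w i.
      rewrite (big_fsetIDI J) (fsetIidPr (fsubsetUl _ _)); congr (_ + _).
      apply: eq_fbigl => i; rewrite /H !inE; case: (boolP (i \in J)) => //= iJ.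
      have /(fsubsetP JA1) := iJ; rewrite inE => /andP[_ iA].
      by rewrite iA /= orbT.
    have cJH : (#|` (J `|` H)%fset| <= #|` F|)%N.
      apply: (@leq_trans (#|` J| + #|` H|)); first by rewrite -cardfsUI leq_addr.
      rewrite cJ /H -fsetDDl /j -[leqRHS](cardfsID G2) leq_add2l.
      by apply: fsubset_leq_card; exact: fsubsetDl.
    apply: (@le_trans _ _ (\sum_(i <- (J `|` H)%fset) w i)).
      rewrite JH lerD2r /r mulrAC ler_pdivrMr// mulrC [leRHS]mulrC.
      exact: le_J.
    have [->|JH0] := eqVneq (J `|` H)%fset fset0.
      by rewrite big_seq_fset0 ltW// phi_gt0// cardfs_ge1.
    apply: le_trans (wphi _ JH0) _; apply: phi_le; first exact: cardfs_ge1.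
    by rewrite ler_nat.
  - under eq_bigr do rewrite -mulrA.
    rewrite -mulr_sumr ler_pdivrMl// sum_w'//.
    have -> : q * (L * `|z|) = c * `|z| + L * `|z|.
      by rewrite /q; field; rewrite gt_eqF.
    apply: lerD; last exact: wdual.
    apply: le_trans (G2dual z); apply: ler_pM => //; first exact: sumr_ge0.
    by apply: ler_fsum_subset => //; exact: fsubsetIr.
have := bounded_weight_le ((E `\` AG) `|` G2)%fset v bww'.
under eq_bigr do rewrite -mulrA.
rewrite -mulr_sumr ler_pdivrMl// sum_w'// => le_v.
apply: le_trans le_v; apply: le_trans (ler_wpM2l _ le_u) _.
  by rewrite subr_ge0 ltW.
rewrite mulrDr addrC; apply: lerD.
  rewrite (fsetIidPr (fsubsetUr _ _)).
  apply: (@le_trans _ _ (r * \sum_(i <- G2) t)).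
    rewrite sum_fset_const mulrA mulrA mulrAC [X in _ <= X]mulrC [X in X <= _]mulrC.
    apply: ler_wpM2l => //.
    have -> : (1 - eta) * s = r * ((1 - eta) * k%:R).
      by rewrite /r; field; rewrite gt_eqF.
    exact: ler_wpM2l.
  apply: ler_wpM2l => //; rewrite !big_seq; apply: ler_sum => i iG2.
  by rewrite vE ?G2A// tG// G2G.
apply: (@le_trans _ _ (1 * \sum_(i <- (E `\` AG)%fset) w i * `|coord e x i|)).
  apply: ler_wpM2r; first by apply: sumr_ge0 => i _; rewrite mulr_ge0.
  by rewrite gerBl.
rewrite mul1r le_eqVlt; apply/orP; left; apply/eqP.
have -> : ((E `\` AG `|` G2) `\` (G2 `|` AG) = (E `\` AG) `\` G2)%fset.
  apply/fsetP => i; rewrite !inE; case: (i \in G2) => //=.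
  by case: (i \in A); case: (i \in G); case: (i \in E).
have -> : ((E `\` AG) `\` G2)%fset = (E `\` AG)%fset.
  apply/fsetP => i; rewrite !inE; case: (boolP (i \in G2)) => //= /G2G ->.
  by rewrite orbT.
rewrite !big_seq; apply: eq_bigr => i; rewrite !inE negb_or => /andP[/andP[iA _] _].
by rewrite vE.
Qed.

End TruncatedLorentz.

(** * The renorming *)

Unset Implicit Arguments.

Theorem theorem11 (R : realType) (X : completeNormedModType R) (e : nat -> X)
    (rho : X -> nat -> nat) (phi : R -> R) :
  schauder_basis e ->
  seminormalized (fun x : X => `|x|) e ->
  (forall x : X, greedy_ordering e x (rho x)) ->
  greedy (fun x : X => `|x|) e rho ->
  fundamental_function_for (fun x : X => `|x|) e phi ->
  (0 < delta phi)%E ->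
  forall eps : R, 0 < eps ->
  exists N : X -> R,
    [/\ is_norm N,
        equivalent_norms (fun x : X => `|x|) N,
        normalized N e,
        unconditional N e 1 &
        greedy_with N e rho (1 + eps)].
Proof.
move=> basis_e seminormalized_e rho_ordering greedy_e phi_for delta_phi eps eps0.
have phi_fundamental := phi_for.1.
have [C [C_ge1 greedy_C]] := greedy_ge1 greedy_e.
pose D := 1 + 3 * C; pose K := 2 * (1 + C).
have D_ge1 : 1 <= D by rewrite /D; lra.
have K_ge1 : 1 <= K by rewrite /K; lra.
have norm_le_phi := norm_le_fundamental seminormalized_e phi_for.
have norming : positively_norming e K :=
  norming_weights basis_e rho_ordering C_ge1 greedy_C.
have phi_le_norm (B : {fset nat}) : B != fset0 -> phi #|` B|%:R <= D * `|\sum_(i <- B) e i|.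
  move=> B0; apply: (fundamental_le_norm phi_for B0) => A.
  exact: (democracy basis_e rho_ordering C_ge1 greedy_C).
have [cmin [M [cmin0 eM]]] := seminormalizedP seminormalized_e.
pose b := (1 + C) / cmin.
have b0 : 0 <= b by rewrite divr_ge0 ?(ltW cmin0)//; lra.
have coord_le z i : `|coord e z i| <= b * `|z|.
  rewrite /b mulrAC ler_pdivlMr//.
  have := projection_le basis_e rho_ordering C_ge1 greedy_C z [fset i]%fset.
  rewrite big_seq_fset1 normrZ; apply: le_trans.
  by rewrite ler_wpM2l//; have /andP[] := eM i.
have [d [d01 dphi]] := delta_gt0 phi_fundamental delta_phi.
(* With this eta, (1 - eta) (1 + eps) = 1 + eps / 2. *)
pose eta := eps / (2 + 2 * eps).
have eta0 : 0 < eta by rewrite divr_gt0//; lra.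
have eta1 : eta < 1 by rewrite /eta ltr_pdivrMr; lra.
have [c [c0 dense]] := dual_dense_almost_full basis_e phi_fundamental D_ge1 K_ge1
  norm_le_phi phi_le_norm norming coord_le d01 dphi eta0.
have phi1 : 0 < phi 1 by case: phi_fundamental => + _ _; apply.
pose L := 1 + 2 * c / eps + phi 1 * b.
have ceps0 : 0 <= 2 * c / eps by rewrite divr_ge0 ?mulr_ge0// ltW.
have phib0 : 0 <= phi 1 * b by rewrite mulr_ge0// ltW.
have L_ge1 : 1 <= L by rewrite /L; lra.
have L0 : 0 < L by exact: lt_le_trans L_ge1.
pose T := truncated_lorentz e phi L.
pose N x := (phi 1)^-1 * T x.
have N0 x : 0 <= N x.
  by rewrite mulr_ge0 ?invr_ge0 ?(ltW phi1)//; exact: truncated_lorentz_ge0.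
have norm_le_T x : `|x| <= K * T x.
  exact: (norm_le_truncated_lorentz basis_e L_ge1 x K_ge1 norm_le_phi norming).
exists N; split.
- split=> [x y|a x|x].
  + by rewrite -mulrDr ler_wpM2l ?invr_ge0 ?(ltW phi1)//; exact: truncated_lorentzD.
  + by rewrite /N mulrCA; congr (_ * _); exact: truncated_lorentzZ.
  + move=> /eqP; rewrite mulf_eq0 invr_eq0 gt_eqF//= => /eqP T0.
    by apply/eqP; rewrite -normr_le0; have := norm_le_T x; rewrite T0 mulr0.
- have K0 : 0 < K by exact: lt_le_trans K_ge1.
  exists (K * phi 1)^-1, ((phi 1)^-1 * L); split.
  + by rewrite invr_gt0 mulr_gt0.
  + by rewrite mulr_gt0 ?invr_gt0.
  + move=> x; apply/andP; split.
      by rewrite (ler_pdivrMl _ _ (mulr_gt0 K0 phi1)) /N mulrA mulfK ?gt_eqF.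
    by rewrite /N -mulrA ler_wpM2l ?invr_ge0 ?(ltW phi1)//; exact: truncated_lorentz_le_norm.
- move=> i; rewrite /N /T (@truncated_lorentz_basis _ _ _ _ _ _ _ _ b)//.
    by rewrite mulVf ?gt_eqF.
  by rewrite /L; lra.
- move=> x y xy; rewrite mul1r ler_wpM2l ?invr_ge0 ?(ltW phi1)//.
  exact: truncated_lorentz_mono.
move=> x m m0; rewrite -ler_pdivrMl; last by lra.
apply: lb_le_inf.
  by exists (N (x - \sum_(i <- fset0) 0 *: e i)), fset0, (fun=> 0).
move=> _ [A [a [Am ->]]].
have [G [cG -> domG]] := greedy_sum_fset m (rho_ordering x).
rewrite ler_pdivrMl; last by lra.
rewrite /N mulrCA ler_pM2l ?invr_gt0//.
rewrite -cG in Am.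
have := truncated_lorentz_exchange basis_e phi_fundamental L_ge1 a c0 _ dense Am domG.
rewrite (ltW eta0) eta1 => /(_ isT) le_T.
have eta_eps : (1 - eta) * (1 + eps) = 1 + eps / 2.
  by rewrite /eta; field; rewrite gt_eqF//; lra.
have eta1' : 0 < 1 - eta by rewrite subr_gt0.
rewrite -(ler_pM2l eta1') mulrA eta_eps; apply: le_trans le_T _.
rewrite ler_wpM2r ?lerD2l; last 2 first.
- exact: truncated_lorentz_ge0.
- rewrite ler_pdivrMr// mulrC -ler_pdivrMr ?divr_gt0//.
  have -> : c / (eps / 2) = 2 * c / eps by field; rewrite gt_eqF.
  by rewrite /L; lra.
by [].
Qed.
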